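(* Let $G=(V,E)$ be a finite simple graph and let $A$ be an arc set of $G$ such that the directed graph $H=(V,A)$ consists of a collection of vertex-disjoint directed paths. Then $A$ is a forcing arc set of $G$ if and only if $A$ does not contain a chain twist.
   Context: Zero forcing: vertices are coloured blue or white; a blue vertex $u$ may force (recolour blue) a white neighbour $v$ if $v$ is the only white vertex in the closed neighbourhood $N[u]$. A zero forcing set of $G$ is a set $B_0$ such that starting with exactly $B_0$ blue and repeatedly applying this rule, all vertices eventually become blue; $Z(G)$ is the minimum size of a zero forcing set. An arc set of $G$ is a set $A$ of ordered pairs $(u,v)$ with $uv\in E$, such that $(u,v)\in A$ implies $(v,u)\notin A$. A source (resp. sink) of $A$ is a vertex of in-degree (resp. out-degree) zero in $(V,A)$. $A$ is a forcing arc set of $G$ if (P1) $(V,A)$ is a collection of vertex-disjoint directed paths (possibly of length zero), and (P2) there is a zero forcing process on $G$, in which each white vertex is forced by exactly one vertex and all vertices become blue, such that $(u,v)\in A$ exactly when $u$ forces $v$ during the process; the initial blue set of this process is the set of sources of $A$. A chain twist in $A$ is a cycle $v_0v_1\dots v_{k-1}v_0$ in $G$ such that for all $i$ (indices modulo $k$): if $(v_i,v_{i+1})\notin A$ then $(v_{i-1},v_i)\in A$ and $(v_{i+1},v_{i+2})\in A$. $A$ contains a chain twist if some cycle of $G$ satisfies this condition. *)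

(* Defs.v *)
From mathcomp Require Import all_boot.

Set Implicit Arguments.
Unset Strict Implicit.
Unset Printing Implicit Defensive.

(* A finite simple graph is a symmetric irreflexive relation E on a finType V. *)

Section ZeroForcing.

Variables (V : finType) (E : rel V).
Implicit Types (A : {set V * V}) (B : {set V}).

Definition arc_set A : Prop :=
  (forall u v, (u, v) \in A -> E u v) /\
  (forall u v, (u, v) \in A -> (v, u) \notin A).

Definition sources A : {set V} := [set v | [forall u, (u, v) \notin A]].

(* Each member of ps is the vertex sequence of one directed path; a singleton
   is a path of length zero.  Distinctness of vertices within a path and
   disjointness of different paths are both expressed by uniq (flatten ps). *)
Definition disjoint_dipaths A : Prop :=
  exists ps : seq (seq V),
    [/\ [::] \notin ps,
        uniq (flatten ps),
        forall x, x \in flatten ps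
      & A = [set a | has (infix [:: a.1; a.2]) ps]].

Definition closed_nbhd (u : V) : {set V} := [set v | (v == u) || E u v].

Definition can_force B (u v : V) : bool :=
  [&& u \in B, E u v & closed_nbhd u :\: B == [set v]].

(* s is the chronological list of forces (u, v), "u forces v", of a process
   that starts with blue set B and ends with every vertex blue. *)
Fixpoint forcing_process B (s : seq (V * V)) : bool :=
  if s is (u, v) :: s' then can_force B u v && forcing_process (v |: B) s'
  else B == [set: V].

Definition forcing_arc_set A : Prop :=
  [/\ arc_set A,
      disjoint_dipaths A
    & exists2 s, forcing_process (sources A) s & A = [set a in s]].

(* c lists the distinct vertices v_0, ..., v_(k-1) of a cycle in cyclic order;
   next c and prev c are the index shifts modulo k. *)
Definition graph_cycle (c : seq V) : Prop := 2 < size c /\ ucycle E c.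

Definition chain_twist A (c : seq V) : Prop :=
  graph_cycle c /\
  forall x, x \in c -> (x, next c x) \notin A ->
    (prev c x, x) \in A /\ (next c x, next c (next c x)) \in A.

Definition contains_chain_twist A : Prop := exists c, chain_twist A c.

End ZeroForcing.

(* Main.v *)
Require Import Defs.
From mathcomp Require Import all_boot.

Set Implicit Arguments.
Unset Strict Implicit.
Unset Printing Implicit Defensive.

(** If a process realises [A], consider the first force along a chain twist:
    the vertex preceding the forcing vertex, or the forcing vertex itself, is
    the head of another arc of the twist and is still white, a contradiction.
    Conversely, suppose that no arc of [A] with a white head can be used.  Send
    each white vertex to its [A]-predecessor, and each blue vertex whose
    [A]-successor is white to another white neighbour, which exists because
    the force is blocked.  A periodic orbit of this map, read backwards, is a
    chain twist. *)

Section DipathDegrees.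

Variables (V : finType) (A : {set V * V}).
Hypothesis A_paths : disjoint_dipaths A.

Lemma dipaths_listing :
  exists2 L : seq V, uniq L &
    forall u v, (u, v) \in A -> exists l1 l2, L = l1 ++ [:: u, v & l2].
Proof.
have [ps [_ uniq_ps _ ->]] := A_paths.
exists (flatten ps) => // u v; rewrite inE => /hasP[p ps_p /infixP[s1 [s2 def_p]]].
case/splitPr: ps_p => q1 q2; exists (flatten q1 ++ s1), (s2 ++ flatten q2).
by rewrite flatten_cat /= def_p -!catA.
Qed.

(** Positions in the concatenation of all paths turn each arc into a step by one, so uniqueness of
    predecessors and successors reduces to injectivity of [index]. *)
Lemma dipaths_index :
  exists2 L : seq V, uniq L &
    forall u v, (u, v) \in A ->
      [/\ u \in L, v \in L & index v L = (index u L).+1].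
Proof.
have [L uniq_L L_A] := dipaths_listing; exists L => // u v /L_A[l1 [l2 defL]].
move: uniq_L; rewrite defL cat_uniq /= !inE !negb_or !mem_cat !inE !eqxx !orbT.
case/and3P=> _ /and3P[l1'u l1'v _] /andP[/andP[neq_uv _] _].
split=> //; rewrite !index_cat (negbTE l1'u) (negbTE l1'v) /= !eqxx.
by rewrite (negbTE neq_uv) addn0 addn1.
Qed.

Lemma dipaths_pred_unique u u' v : (u, v) \in A -> (u', v) \in A -> u = u'.
Proof.
have [L _ LA] := dipaths_index => /LA[Lu _ def_v] /LA[Lu' _].
by rewrite def_v => -[]; apply: index_inj.
Qed.

Lemma dipaths_succ_unique u v v' : (u, v) \in A -> (u, v') \in A -> v = v'.
Proof.
have [L _ LA] := dipaths_index => /LA[_ Lv def_v] /LA[_ Lv' def_v'].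
by apply: (index_inj v Lv Lv'); rewrite def_v def_v'.
Qed.

End DipathDegrees.

(** If [x] is not periodic, passing to [f x] lowers the order by one; iteration stops at a periodic
    point, whose orbit is the cycle. *)
Lemma fcycle_in (T : finType) (f : T -> T) (S : {pred T}) (x : T) :
    x \in S -> {in S, forall y, f y \in S} ->
  exists c : seq T, [/\ c != [::], {subset c <= S}, fcycle f c & uniq c].
Proof.
move=> Sx Sf; have [n] := ubnP (order f x).
elim: n => // n IHn in x Sx *; case: (orderPcycle f x) => [cyc_x _ _ | _ ->].
  exists (orbit f x); split=> //; first by rewrite -size_eq0 size_orbit -lt0n.
  by move=> y /trajectP[i _ ->]; elim: i => //= i; apply: Sf.
by rewrite ltnS => /IHn; apply; apply: Sf.
Qed.

Lemma next_neq_prev (T : eqType) (c : seq T) (x : T) :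
  2 < size c -> uniq c -> x \in c -> next c x != prev c x.
Proof.
move=> c_gt2 uniq_c /rot_to[i c' def_c]; apply/eqP=> next_prev_x.
have: next c (next c x) = x by rewrite next_prev_x next_prev.
rewrite -!(next_rot i uniq_c).
move: c_gt2 uniq_c; rewrite -(size_rot i) -(rot_uniq i) def_c.
case: c' {def_c} => [|y [|z c']] //= _ /and3P[/norP[neq_xy /norP[neq_xz _]] _ _].
by rewrite !eqxx eq_sym (negbTE neq_xy) => /eqP; rewrite eq_sym (negbTE neq_xz).
Qed.

Section ChainTwist.

Variables (V : finType) (E : rel V) (A : {set V * V}).
Hypotheses (E_sym : symmetric E) (E_irr : irreflexive E).
Hypotheses (A_arc : arc_set E A) (A_paths : disjoint_dipaths A).

Lemma twist_has_arc (c : seq V) :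
  chain_twist E A c -> exists2 x, x \in c & (x, next c x) \in A.
Proof.
case=> -[c_gt2 _] twist.
have [x c_x] : exists x, x \in c.
  by case: c c_gt2 {twist} => // x c; exists x; rewrite mem_head.
have [Ax | /(twist _ c_x)[_ Anx]] := boolP ((x, next c x) \in A).
  by exists x.
by exists (next c x); rewrite ?mem_next.
Qed.

(** Whiteness of the heads of twist arcs is the invariant of the induction on [s]: no force breaks
    it, and it excludes an all-blue end. *)
Lemma white_twist_not_forced s (c : seq V) (B : {set V}) :
    chain_twist E A c -> {subset s <= A} ->
    {in c, forall x, (x, next c x) \in A -> next c x \notin B} ->
  ~~ forcing_process E B s.
Proof.
move=> twist_c; have [x0 c_x0 Ax0] := twist_has_arc twist_c.
case: twist_c => -[c_gt2 /andP[cycE uniq_c]] twist.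
elim: s B => [|[u v] s IHs] B /= sA white.
  by apply: contraNneq (white _ c_x0 Ax0) => ->; rewrite inE.
have Auv : (u, v) \in A by apply: sA; rewrite mem_head.
apply/andP=> -[/and3P[Bu Euv /eqP N_u]]; apply/negP/IHs => [a s_a | x c_x Ax].
  by rewrite sA // inE s_a orbT.
rewrite !inE negb_or white // andbT; apply: contraL (Bu) => /eqP def_v.
have def_u: u = x by apply: (dipaths_pred_unique A_paths Auv); rewrite -def_v.
subst u; rewrite -def_v in N_u.
(* If [(p, x)] is an arc, then [x] is a white head although it forces. Otherwise the twist condition
   at [p] makes [p] the head of an arc, hence a second white neighbour of [x]. *)
set p := prev c x; have c_p : p \in c by rewrite mem_prev.
have np: next c p = x by rewrite next_prev.
have [Ap | notAp] := boolP ((p, x) \in A).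
  by have := white _ c_p; rewrite np => ->.
have [|] := twist _ c_p; first by rewrite np.
set q := prev c p => Aq _; have c_q : q \in c by rewrite mem_prev.
have Bp: p \notin B by have := white _ c_q; rewrite /q next_prev // => ->.
have /setP/(_ p) := N_u; rewrite !inE Bp E_sym (prev_cycle cycE c_x) orbT.
by rewrite eq_sym (negbTE (next_neq_prev _ _ _)).
Qed.

Lemma forcible_arc (B : {set V}) :
    ~ contains_chain_twist E A -> sources A \subset B -> B != [set: V] ->
  exists u v, (u, v) \in A /\ can_force E B u v.
Proof.
move=> no_twist srcB neqBT; have [A_E A_anti] := A_arc.
have [/existsP[[u v] /andP[Auv uvF]] | /existsPn stuck] :=
  boolP [exists a : V * V, (a \in A) && can_force E B a.1 a.2].
  by exists u, v.
case: no_twist.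
pose R x y := if x \in B then [&& y \notin B, E x y & (x, y) \notin A]
              else (y, x) \in A.
pose S := [pred x | (x \notin B) || [exists v, ((x, v) \in A) && (v \notin B)]].
(* The default [x] is never returned on [S], as [hP] shows. *)
pose h x := odflt x [pick y in S | R x y].
have hP x : x \in S -> h x \in S /\ R x (h x).
  rewrite /h; case: pickP => [y /andP[] // | noR Sx]; exfalso.
  have [Bx | B'x] := boolP (x \in B); last first.
    have: x \notin sources A by exact: contra (subsetP srcB x) B'x.
    rewrite inE negb_forall => /existsP[y]; rewrite negbK => Ayx.
    have := noR y; rewrite /R (negbTE B'x) Ayx andbT !inE => /negP; apply.
    by apply/orP; right; apply/existsP; exists x; rewrite Ayx.
  (* If [v] were the only white neighbour of [x], the arc [(x, v)] could force. Another white
     neighbour [y] gives [R x y], since [v] is the only successor of [x]. *)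
  move: Sx; rewrite inE Bx => /existsP[v /andP[Axv B'v]].
  have := stuck (x, v); rewrite Axv /can_force Bx (A_E _ _ Axv) /=.
  case/eqP; apply/setP=> y; rewrite !inE.
  have [-> | neq_yv] := eqVneq y v; first by rewrite B'v (A_E _ _ Axv) orbT.
  apply/negP=> /andP[B'y /predU1P[def_y | Exy]]; first by rewrite def_y Bx in B'y.
  have := noR y; rewrite /R Bx B'y Exy !inE B'y /= => /negP[].
  by move=> Axy; rewrite (dipaths_succ_unique A_paths Axy Axv) eqxx in neq_yv.
have [x0 Sx0] : exists x0, x0 \in S.
  have /subsetPn[x _ B'x] : ~~ ([set: V] \subset B) by rewrite subTset.
  by exists x; rewrite inE B'x.
have [c [c_n0 cS cyc_c uniq_c]] := fcycle_in Sx0 (fun x Sx => proj1 (hP x Sx)).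
have Rh x : x \in c -> R x (h x) by move/cS/hP=> [].
have ch x : x \in c -> h x \in c by apply: mem_fcycle.
have hE x : x \in c -> E (h x) x.
  by move/Rh; rewrite /R; case: ifP => _; [case/and3P=> _; rewrite E_sym | move/A_E].
(* This excludes orbits of length two; irreflexivity of [E] excludes length one. *)
have hh x : x \in c -> h (h x) != x.
  move=> c_x; apply/eqP=> hhx; have := Rh _ (ch _ c_x); have := Rh _ c_x.
  rewrite hhx /R; case: ifP => [Bx /and3P[/negbTE-> _ /negP] // | B'x Ahx].
  by case: ifP => [_ | _ Axh]; [rewrite Ahx !andbF | case/negP: (A_anti _ _ Ahx)].
exists (rev c); split.
  split; last first.
    rewrite /ucycle rev_uniq uniq_c andbT rev_cycle.
    apply: cycle_from_next => // x c_x.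
    by rewrite (nextE cyc_c) // hE.
  rewrite size_rev.
  case: c c_n0 cyc_c hh hE {cS uniq_c Rh ch} => [|x [|y [|z c]]] //= _.
    by rewrite andbT => /eqP hx _ /(_ x (mem_head _ _)); rewrite hx E_irr.
  by case/and3P=> /eqP hx /eqP hy _ /(_ x (mem_head _ _)); rewrite hx hy eqxx.
move=> x; rewrite mem_rev !next_rev // prev_rev // => c_x.
rewrite (nextE cyc_c c_x).
have c_z : prev c x \in c by rewrite mem_prev.
have c_w : prev c (prev c x) \in c by rewrite mem_prev.
have hz : h (prev c x) = x by rewrite -(nextE cyc_c c_z) next_prev.
have hw : h (prev c (prev c x)) = prev c x by rewrite -(nextE cyc_c c_w) next_prev.
(* In [rev c] the vertex [prev c x] follows [x]. If it is white, [(x, prev c x)] is an arc. If it is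
   blue, then its image [x] is white and has the arc from [h x]; and the vertex mapped to it must be
   white, since blue vertices map to white ones, which gives the other arc. *)
have := Rh _ c_z; rewrite {1}/R hz.
case: ifP => [Bz /and3P[B'x _ _] _ | _ -> //].
have := Rh _ c_x; have := Rh _ c_w; rewrite hw /R (negbTE B'x) Bz /=.
by case: ifP.
Qed.

(** Describing [s] as the arcs with white head lets the induction on the number of white vertices go
    through; for [B] the set of sources these are all arcs of [A]. *)
Lemma forcing_process_exists (B : {set V}) :
    ~ contains_chain_twist E A -> sources A \subset B ->
  exists2 s, forcing_process E B s &
    forall a, (a \in s) = (a \in A) && (a.2 \notin B).
Proof.
move=> no_twist; have [n] := ubnP #|~: B|; elim: n => // n IHn in B *.
rewrite ltnS => leBn srcB.
have [defB | neqBT] := eqVneq B setT.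
  by exists [::] => [|a]; rewrite /= defB ?inE ?andbF.
have [u [v [Auv uvF]]] := forcible_arc no_twist srcB neqBT.
have B'v : v \notin B.
  by case/and3P: uvF => _ _ /eqP/setP/(_ v); rewrite !inE eqxx => /andP[].
have [||s proc_s def_s] := IHn (v |: B).
- apply: leq_trans leBn; apply/proper_card.
  rewrite properC properEneq subsetUr andbT.
  by apply: contraNneq B'v => ->; rewrite setU11.
- exact: subset_trans srcB (subsetUr _ _).
exists ((u, v) :: s) => [|[w y]] /=; first by rewrite uvF.
rewrite inE def_s !inE xpair_eqE /=.
(* Colouring [v] blue discards only [(u, v)], the one arc with head [v]. *)
have [-> | neq_yv] := eqVneq y v; last by rewrite andbF.
rewrite B'v andbF andbT orbF andbT; apply/eqP/idP => [-> // | Awv].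
exact: (dipaths_pred_unique A_paths Awv Auv).
Qed.

End ChainTwist.

Theorem theorem2p4 (V : finType) (E : rel V)
    (E_sym : symmetric E) (E_irr : irreflexive E)
    (A : {set V * V}) (A_arc : arc_set E A) (A_paths : disjoint_dipaths A) :
  forcing_arc_set E A <-> ~ contains_chain_twist E A.
Proof.
have not_src u v : (u, v) \in A -> v \notin sources A.
  by move=> Auv; rewrite inE; apply/forallPn; exists u; rewrite negbK.
split=> [[_ _ [s proc_s defA]] [c twist_c] | no_twist].
  apply/negP: proc_s; apply: (white_twist_not_forced E_sym A_paths twist_c).
    by move=> a s_a; rewrite defA inE.
  by move=> x _; apply: not_src.
have [s proc_s def_s] :=
  forcing_process_exists E_sym E_irr A_arc A_paths no_twist (subxx _).
split=> //; exists s => //; apply/setP=> -[u v]; rewrite inE def_s.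
by apply/idP/andP => [Auv | []//]; split; rewrite ?(not_src u).
Qed.
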